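(* Let $g=\sum_{n=0}^\infty b_nz^n$ and $h=\sum_{n=0}^\infty c_nz^n$ be formal power series over $\mathbb C$ (that is, formal Laurent series with $\deg_-(g)=\deg_-(h)=0$), and let $f=\sum_{n\in\mathbb Z}a_nz^n$ be a formal Laurent series over $\mathbb C$ such that the compositions $|g|\circ|f|$ and $|h|\circ|f|$ exist and either (a) $(|g|\circ|f|)(|h|\circ|f|)$ exists, or (b) $(|g||h|)\circ|f|$ exists. Then $(g\circ f)(h\circ f)$ and $(gh)\circ f$ exist and $(g\circ f)(h\circ f)=(gh)\circ f$.
   Context: A formal Laurent series over $\mathbb C$ is a mapping $f:\mathbb Z\to\mathbb C$, written $f=\sum_{n\in\mathbb Z}a_nz^n$ with $a_n=f(n)$ (arbitrarily many nonzero coefficients with negative index are allowed); $|f|:=\sum_{n\in\mathbb Z}|a_n|z^n$. For complex $(c_n)_{n\in\mathbb Z}$, $\sum_{n\in\mathbb Z}c_n:=\sum_{n=1}^\infty c_{-n}+\sum_{n=0}^\infty c_n$, convergent iff both one-sided series converge. The product of $g=\sum b_nz^n$ and $f=\sum a_nz^n$ is $gf:=\sum_{n\in\mathbb Z}\left(\sum_{m\in\mathbb Z}b_ma_{n-m}\right)z^n$, provided all sums over $m$ converge; otherwise $gf$ does not exist. Powers: $f^0:=1$ (coefficients $\delta_{n,0}$), $f^1:=f$, $f^k:=f^{k-1}f$ for $k>1$ provided $f^{k-1}$ and the product $f^{k-1}f$ exist; write $f^k=\sum_{n\in\mathbb Z}a_n^{(k)}z^n$. $\deg_+(g):=\sup\{n\ge0:b_n\ne0\}$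 and $\deg_-(g):=\sup\{n\ge 1:b_{-n}\ne0\}$, with $\sup\emptyset:=0$; both may be $+\infty$. A formal Laurent series $g$ with $\deg_-(g)=0$ is regarded as a formal power series. Composition: for a formal power series $g=\sum_{k=0}^\infty b_kz^k$ and a formal Laurent series $f$, the composition $g\circ f$ exists iff $f^k$ exists for every integer $0\le k\le\deg_+(g)$ (for every $k\ge0$ if $\deg_+(g)=+\infty$) and $\sum_{k=0}^{\deg_+(g)}b_ka_n^{(k)}$ converges for all $n\in\mathbb Z$; then $g\circ f:=\sum_{n\in\mathbb Z}\left(\sum_{k=0}^{\deg_+(g)}b_ka_n^{(k)}\right)z^n$. *)

(* Defs.v *)
From Stdlib Require Import Reals ZArith.
From Coquelicot Require Import Coquelicot.

Open Scope C_scope.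

(* The coefficient function n |-> a_n; no condition on its support. *)
Definition laurent := Z -> C.

Definition laurent_abs (f : laurent) : laurent := fun n => RtoC (Cmod (f n)).

Definition laurent_one : laurent := fun n => if Z.eq_dec n 0 then 1 else 0.

(* sum_{n in Z} c_n = l: both one-sided series converge, with sums adding
   up to l; the index of the negative part is shifted so as to start at -1. *)
Definition is_sumZ (c : Z -> C) (l : C) : Prop :=
  exists lneg lpos : C,
    is_series (fun n : nat => c (- Z.of_nat (S n))%Z) lneg /\
    is_series (fun n : nat => c (Z.of_nat n)) lpos /\
    l = lneg + lpos.

(* The partial operations are given by their graphs: [is_prod g f p] reads
   "gf exists and equals p", and likewise for [is_pow] and [is_comp]. *)
Definition is_prod (g f p : laurent) : Prop :=
  forall n : Z, is_sumZ (fun m : Z => g m * f (n - m)%Z) (p n).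

Fixpoint is_pow (f : laurent) (k : nat) (p : laurent) : Prop :=
  match k with
  | O => p = laurent_one
  | S O => p = f
  | S k' => exists q : laurent, is_pow f k' q /\ is_prod q f p
  end.

(* Degrees live in Rbar since they may be +oo; adjoining 0 to the sets
   implements the convention that the supremum of the empty set is 0. *)
Definition deg_plus (g : laurent) : Rbar :=
  Lub_Rbar (fun x : R =>
    x = 0%R \/ exists n : nat, g (Z.of_nat n) <> 0 /\ x = INR n).

Definition deg_minus (g : laurent) : Rbar :=
  Lub_Rbar (fun x : R =>
    x = 0%R \/
    exists n : nat, (1 <= n)%nat /\ g (- Z.of_nat n)%Z <> 0 /\ x = INR n).

Definition is_power_series (g : laurent) : Prop := deg_minus g = Finite 0.

(* sum_{k=0}^{d} c_k = l, a finite sum if d is finite and a series if d = +oo. *)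
Definition is_sum_upto (d : Rbar) (c : nat -> C) (l : C) : Prop :=
  is_series
    (fun k : nat => if Rbar_le_dec (Finite (INR k)) d then c k else RtoC 0) l.

(* [P k] is f^k for k <= deg_plus g; its other values are irrelevant. *)
Definition is_comp (g f p : laurent) : Prop :=
  is_power_series g /\
  exists P : nat -> laurent,
    (forall k : nat, Rbar_le (Finite (INR k)) (deg_plus g) -> is_pow f k (P k)) /\
    (forall n : Z,
       is_sum_upto (deg_plus g) (fun k : nat => g (Z.of_nat k) * P k n) (p n)).

(* Main.v *)
Require Import Defs.
From Stdlib Require Import Reals ZArith Lra Lia List FinFun.
From Stdlib Require Import Classical ClassicalEpsilon FunctionalExtensionality.
From Coquelicot Require Import Coquelicot.

(** Two formal operations are being compared that each hide an infinite
    rearrangement.  Expanding both sides formally, coefficient [n] of either one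
    is the sum of

      [g k * f^k m * (h l * f^l (n - m))]      over all integers [m], [k], [l].

    Summing over [(k, l)] first gives [sum_m (g o f) m * (h o f) (n - m)]; summing
    over [m] first gives, by [f^k f^l = f^(k+l)], the sum over [(k, l)] of
    [g k * h l * f^(k+l) n], which collects along the diagonals [k + l = s] into
    [((g h) o f) n].  So everything follows from Fubini's theorem once this triple
    family is absolutely summable (lemma [comp_mult]).

    Absolute summability may be checked after replacing [g], [h], [f] by their
    moduli, because [|f^k| <= |f|^k] coefficientwise ([lpow_le]); then Tonelli's
    theorem applies, and convergence of either iterated sum suffices.  Hypothesis
    (a) is convergence of the iterated sum with [(k, l)] inside
    ([summable_prod_term_prod]), hypothesis (b) that with [m] inside
    ([summable_prod_term_comp]).

    Existence of powers is the other issue: [(g h) o f] involves [f^(k+l)] for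
    nonzero [g k] and [h l], whereas the compositions [|g| o |f|] and [|h| o |f|]
    only provide powers up to the two separate degrees.  Under (b) these powers
    are part of the hypothesis.  Under (a) the triple sum shows that
    [|f|^k |f|^l] exists, and since [|f|^l = |f|^(l-1) |f|], associativity of
    nonnegative products yields [|f|^(k+l)] by induction on [l]
    ([pow_summable_add]).

    The sums are treated as unconditional sums over an arbitrary index type, so
    that Fubini, Tonelli and reindexing along bijections are available in one
    uniform form; all exponents range over [Z], with [g] and [h] vanishing at
    negative integers, which turns the collection along diagonals into a
    reindexing of [Z * Z]. *)

Local Open Scope C_scope.

(** * Finite sums *)

Fixpoint lsumR {I : Type} (u : I -> R) (L : list I) : R :=
  match L with nil => 0%R | i :: L' => (u i + lsumR u L')%R end.

Fixpoint lsum {I : Type} (c : I -> C) (L : list I) : C :=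
  match L with nil => 0 | i :: L' => c i + lsum c L' end.

Lemma lsumR_app {I} (u : I -> R) L1 L2 :
  lsumR u (L1 ++ L2) = (lsumR u L1 + lsumR u L2)%R.
Proof. induction L1 as [|i L1 IH]; simpl; [ring | rewrite IH; ring]. Qed.

Lemma lsum_app {I} (c : I -> C) L1 L2 : lsum c (L1 ++ L2) = lsum c L1 + lsum c L2.
Proof. induction L1 as [|i L1 IH]; simpl; [ring | rewrite IH; ring]. Qed.

Lemma lsumR_ge0 {I} (u : I -> R) L : (forall i, 0 <= u i)%R -> (0 <= lsumR u L)%R.
Proof. intros Hu; induction L as [|i L IH]; simpl; [lra | specialize (Hu i); lra]. Qed.

Lemma lsumR_le {I} (u v : I -> R) L :
  (forall i, u i <= v i)%R -> (lsumR u L <= lsumR v L)%R.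
Proof. intros Hu; induction L as [|i L IH]; simpl; [lra | specialize (Hu i); lra]. Qed.

Lemma lsumR_scal {I} (k : R) (u : I -> R) L :
  lsumR (fun i => (k * u i)%R) L = (k * lsumR u L)%R.
Proof. induction L as [|i L IH]; simpl; [ring | rewrite IH; ring]. Qed.

Lemma lsum_plus {I} (c d : I -> C) L :
  lsum (fun i => c i + d i) L = lsum c L + lsum d L.
Proof. induction L as [|i L IH]; simpl; [ring | rewrite IH; ring]. Qed.

Lemma lsum_scal {I} (k : C) (c : I -> C) L : lsum (fun i => k * c i) L = k * lsum c L.
Proof. induction L as [|i L IH]; simpl; [ring | rewrite IH; ring]. Qed.

Lemma lsum_RtoC {I} (u : I -> R) L : lsum (fun i => RtoC (u i)) L = RtoC (lsumR u L).
Proof. induction L as [|i L IH]; simpl; [reflexivity | rewrite IH, RtoC_plus; reflexivity]. Qed.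

Lemma lsum_map {I J} (phi : J -> I) (c : I -> C) L :
  lsum c (map phi L) = lsum (fun j => c (phi j)) L.
Proof. induction L as [|i L IH]; simpl; congruence. Qed.

Lemma lsumR_map {I J} (phi : J -> I) (u : I -> R) L :
  lsumR u (map phi L) = lsumR (fun j => u (phi j)) L.
Proof. induction L as [|i L IH]; simpl; congruence. Qed.

Lemma lsum_prod {I J} (c : I * J -> C) L1 L2 :
  lsum c (list_prod L1 L2) = lsum (fun i => lsum (fun j => c (i, j)) L2) L1.
Proof.
  induction L1 as [|i L1 IH]; simpl; [reflexivity|].
  rewrite lsum_app, lsum_map, IH; reflexivity.
Qed.

Lemma lsumR_prod {I J} (u : I * J -> R) L1 L2 :
  lsumR u (list_prod L1 L2) = lsumR (fun i => lsumR (fun j => u (i, j)) L2) L1.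
Proof.
  induction L1 as [|i L1 IH]; simpl; [reflexivity|].
  rewrite lsumR_app, lsumR_map, IH; reflexivity.
Qed.

Lemma lsum_zero {I} (c : I -> C) L : (forall i, In i L -> c i = 0) -> lsum c L = 0.
Proof.
  induction L as [|i L IH]; simpl; intros H; [reflexivity|].
  rewrite (H i), IH; auto; ring.
Qed.

Lemma lsum_exchange {I J} (c : I -> J -> C) L1 L2 :
  lsum (fun i => lsum (c i) L2) L1 = lsum (fun j => lsum (fun i => c i j) L1) L2.
Proof.
  induction L1 as [|i L1 IH]; simpl.
  - symmetry; apply lsum_zero; reflexivity.
  - rewrite IH, <- lsum_plus; reflexivity.
Qed.

Lemma NoDup_prod {I J} (L1 : list I) (L2 : list J) :
  NoDup L1 -> NoDup L2 -> NoDup (list_prod L1 L2).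
Proof.
  intros H1 H2; induction H1 as [|i L1 Hi _ IH]; simpl; [constructor|].
  apply NoDup_app.
  - apply Injective_map_NoDup; auto; intros x y E; congruence.
  - exact IH.
  - intros [a b] Ha Hb; apply in_map_iff in Ha as (y & E & _).
    apply in_prod_iff in Hb as [Hb _]; congruence.
Qed.

(** Only the support of [u] on [L] needs to be covered: this serves both for
    monotonicity in the list and for families of finite support. *)
Lemma lsumR_incl {I} (u : I -> R) (L L' : list I) :
  (forall i, 0 <= u i)%R -> NoDup L ->
  (forall i, In i L -> u i <> 0%R -> In i L') ->
  (lsumR u L <= lsumR u L')%R.
Proof.
  intros Hu HL; revert L'; induction HL as [|i L Hi HL IH]; intros L' Hinc; simpl.
  - now apply lsumR_ge0.
  - destruct (Req_dec (u i) 0) as [Z | NZ].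
    + rewrite Z, Rplus_0_l; apply IH; intros j Hj; apply Hinc; now right.
    + destruct (in_split i L') as (l1 & l2 & ->); [apply Hinc; simpl; auto|].
      assert (IH' := IH (l1 ++ l2)).
      rewrite lsumR_app in *; simpl.
      enough (lsumR u L <= lsumR u l1 + lsumR u l2)%R by lra.
      apply IH'; intros j Hj Nj.
      assert (Hj' := Hinc j (or_intror Hj) Nj).
      apply in_app_iff in Hj'; simpl in Hj'; apply in_app_iff.
      destruct Hj' as [?|[<-|?]]; tauto.
Qed.

Lemma lsum_support {I} (c : I -> C) (L0 L : list I) :
  NoDup L0 -> NoDup L -> incl L0 L -> (forall i, In i L -> ~ In i L0 -> c i = 0) ->
  lsum c L = lsum c L0.
Proof.
  intros H0; revert L; induction H0 as [|i L0 Hi H0 IH]; intros L HL Hinc Hz; simpl.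
  - apply lsum_zero; intros i Hi; apply Hz; auto.
  - destruct (in_split i L) as (l1 & l2 & ->); [apply Hinc; simpl; auto|].
    assert (Hn := NoDup_remove _ _ _ HL).
    rewrite lsum_app; simpl.
    transitivity (c i + lsum c (l1 ++ l2)); [rewrite lsum_app; ring|].
    f_equal; apply IH; try tauto.
    + intros j Hj; assert (Hj' := Hinc j (or_intror Hj)).
      apply in_app_iff in Hj'; simpl in Hj'; apply in_app_iff.
      destruct Hj' as [?|[<-|?]]; tauto.
    + intros j Hj Nj; apply Hz.
      * apply in_app_iff; apply in_app_iff in Hj; simpl; tauto.
      * intros [<-|?]; tauto.
Qed.

(** * Unconditional sums *)

Definition modulus {I : Type} (c : I -> C) (i : I) : R := Cmod (c i).

Definition summable {I : Type} (c : I -> C) : Prop :=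
  exists M : R, forall L, NoDup L -> (lsumR (modulus c) L <= M)%R.

(** Convergence along the net of finite subsets of [I], a finite subset being a
    duplicate-free list. *)
Definition has_sum {I : Type} (c : I -> C) (l : C) : Prop :=
  forall eps : posreal, exists L0 : list I,
    forall L, NoDup L -> incl L0 L -> (Cmod (lsum c L - l) < eps)%R.

(** The sum of a summable family; an arbitrary number otherwise. Having it as a
    total function turns iterated sums into ordinary nested terms. *)
Definition tsum {I : Type} (c : I -> C) : C := epsilon (inhabits (RtoC 0)) (has_sum c).

Definition eq_dec_of {I : Type} (x y : I) : {x = y} + {x <> y} :=
  excluded_middle_informative (x = y).

Lemma modulus_ge0 {I} (c : I -> C) i : (0 <= modulus c i)%R.
Proof. apply Cmod_ge_0. Qed.

(** Any two finite subsets have a common finite superset, on which both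
    approximations hold. *)
Lemma has_sum_unique {I} (c : I -> C) l1 l2 : has_sum c l1 -> has_sum c l2 -> l1 = l2.
Proof.
  intros H1 H2.
  destruct (Req_dec (Cmod (l1 - l2)) 0) as [E|N].
  - apply Cmod_eq_0 in E. replace l1 with (l1 - l2 + l2) by ring; rewrite E; ring.
  - assert (P : (0 < Cmod (l1 - l2) / 2)%R) by (assert (H := Cmod_ge_0 (l1 - l2)); lra).
    destruct (H1 (mkposreal _ P)) as [L1 K1], (H2 (mkposreal _ P)) as [L2 K2].
    set (L := nodup eq_dec_of (L1 ++ L2)).
    assert (HL : NoDup L) by apply NoDup_nodup.
    assert (Hi : forall i, In i (L1 ++ L2) -> In i L) by (intros; now apply nodup_In).
    specialize (K1 L HL (fun i H => Hi i (in_or_app _ _ _ (or_introl H)))).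
    specialize (K2 L HL (fun i H => Hi i (in_or_app _ _ _ (or_intror H)))).
    simpl in K1, K2.
    assert (T := Cmod_triangle (lsum c L - l2) (- (lsum c L - l1))).
    rewrite Cmod_opp in T.
    replace (lsum c L - l2 + - (lsum c L - l1)) with (l1 - l2) in T by ring.
    lra.
Qed.

Lemma has_sum_plus {I} (c d : I -> C) l m :
  has_sum c l -> has_sum d m -> has_sum (fun i => c i + d i) (l + m).
Proof.
  intros H1 H2 eps.
  destruct (H1 (pos_div_2 eps)) as [L1 K1], (H2 (pos_div_2 eps)) as [L2 K2].
  exists (L1 ++ L2); intros L HL Hinc.
  specialize (K1 L HL (fun i H => Hinc i (in_or_app _ _ _ (or_introl H)))).
  specialize (K2 L HL (fun i H => Hinc i (in_or_app _ _ _ (or_intror H)))).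
  simpl in K1, K2. rewrite lsum_plus.
  assert (T := Cmod_triangle (lsum c L - l) (lsum d L - m)).
  replace (lsum c L + lsum d L - (l + m)) with (lsum c L - l + (lsum d L - m)) by ring.
  lra.
Qed.

Lemma has_sum_scal {I} (k : C) (c : I -> C) l :
  has_sum c l -> has_sum (fun i => k * c i) (k * l).
Proof.
  intros H eps.
  assert (P := Cmod_ge_0 k).
  assert (Q : (0 < eps / (Cmod k + 1))%R)
    by (apply Rdiv_lt_0_compat; [apply cond_pos | lra]).
  destruct (H (mkposreal _ Q)) as [L0 K]; exists L0; intros L HL Hinc.
  specialize (K L HL Hinc); simpl in K.
  rewrite lsum_scal.
  replace (k * lsum c L - k * l) with (k * (lsum c L - l)) by ring.
  rewrite Cmod_mult.
  assert (B := Cmod_ge_0 (lsum c L - l)).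
  apply Rle_lt_trans with ((Cmod k + 1) * Cmod (lsum c L - l))%R; [nra|].
  apply Rlt_le_trans with ((Cmod k + 1) * (eps / (Cmod k + 1)))%R.
  - apply Rmult_lt_compat_l; lra.
  - right; field; lra.
Qed.

Lemma has_sum_finite {I} (c : I -> C) (L0 : list I) :
  NoDup L0 -> (forall i, ~ In i L0 -> c i = 0) -> has_sum c (lsum c L0).
Proof.
  intros H0 Hz eps; exists L0; intros L HL Hinc.
  rewrite (lsum_support c L0 L); auto.
  replace (lsum c L0 - lsum c L0) with (RtoC 0) by ring.
  rewrite Cmod_0; apply cond_pos.
Qed.

Lemma summable_finite {I} (c : I -> C) (L0 : list I) :
  (forall i, ~ In i L0 -> c i = 0) -> summable c.
Proof.
  intros Hz; exists (lsumR (modulus c) L0); intros L HL.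
  apply lsumR_incl; auto using modulus_ge0.
  intros i _ Ni; apply NNPP; intros Hi; apply Ni.
  unfold modulus; rewrite (Hz i Hi); apply Cmod_0.
Qed.

Lemma summable_le {I} (c d : I -> C) :
  (forall i, Cmod (c i) <= Cmod (d i))%R -> summable d -> summable c.
Proof.
  intros H [M HM]; exists M; intros L HL.
  apply Rle_trans with (2 := HM L HL); now apply lsumR_le.
Qed.

Lemma summable_scal {I} (k : C) (c : I -> C) : summable c -> summable (fun i => k * c i).
Proof.
  intros [M HM]; exists (Cmod k * M)%R; intros L HL.
  unfold modulus; replace (fun i => Cmod (k * c i)) with (fun i => (Cmod k * modulus c i)%R).
  - rewrite lsumR_scal; apply Rmult_le_compat_l; auto using Cmod_ge_0.
  - extensionality i; now rewrite Cmod_mult.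
Qed.

(** The sum is the supremum of the finite sums. *)
Lemma has_sum_nonnegative_bounded {I} (u : I -> R) (M : R) :
  (forall i, 0 <= u i)%R -> (forall L, NoDup L -> lsumR u L <= M)%R ->
  exists s : R, has_sum (fun i => RtoC (u i)) (RtoC s).
Proof.
  intros Hu HM.
  destruct (completeness (fun x => exists L, NoDup L /\ x = lsumR u L)) as [s [Hub Hlub]].
  - exists M; intros x (L & HL & ->); auto.
  - exists 0%R, nil; split; [constructor | reflexivity].
  - exists s; intros eps.
    assert (E : exists L0, NoDup L0 /\ (s - eps < lsumR u L0)%R).
    { apply NNPP; intros N.
      assert (s <= s - eps)%R; [|destruct eps; simpl in *; lra].
      apply Hlub; intros x (L & HL & ->).
      apply Rnot_lt_le; intros Hlt; apply N; eauto. }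
    destruct E as (L0 & HL0 & Hlt); exists L0; intros L HL Hinc.
    rewrite lsum_RtoC, <- RtoC_minus, Cmod_R.
    assert (lsumR u L <= s)%R by (apply Hub; eauto).
    assert (lsumR u L0 <= lsumR u L)%R by (apply lsumR_incl; auto).
    apply Rabs_def1; destruct eps; simpl in *; lra.
Qed.

(** A real [v] dominated by the modulus [u] is the difference of [u + v] and [u],
    both nonnegative with bounded finite sums; real and imaginary parts are
    of this kind. *)
Lemma summable_has_sum {I} (c : I -> C) : summable c -> exists l, has_sum c l.
Proof.
  intros [M HM].
  assert (Bd : forall v : I -> R, (forall i, Rabs (v i) <= modulus c i)%R ->
            exists s, has_sum (fun i => RtoC (v i)) s).
  { intros v Hv.
    destruct (has_sum_nonnegative_bounded (modulus c) M) as [s Hs]; auto using modulus_ge0.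
    destruct (has_sum_nonnegative_bounded (fun i => (modulus c i + v i)%R) (2 * M)) as [t Ht].
    - intros i; specialize (Hv i); apply Rabs_le_between in Hv; lra.
    - intros L HL; apply Rle_trans with (lsumR (fun i => (2 * modulus c i)%R) L).
      + apply lsumR_le; intros i; specialize (Hv i); apply Rabs_le_between in Hv; lra.
      + rewrite lsumR_scal; specialize (HM L HL); lra.
    - exists (RtoC t + (- (1)) * RtoC s).
      replace (fun i => RtoC (v i)) with
        (fun i => RtoC (modulus c i + v i) + (- (1)) * RtoC (modulus c i)).
      + now apply has_sum_plus, has_sum_scal.
      + extensionality i; rewrite RtoC_plus; ring. }
  destruct (Bd (fun i => Re (c i))) as [s Hs].
  { intros i; apply re_le_Cmod. }
  destruct (Bd (fun i => Im (c i))) as [t Ht].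
  { intros i; apply Rle_trans with (2 := Rmax_Cmod (c i)); apply Rmax_r. }
  exists (s + Ci * t).
  replace c with (fun i => RtoC (Re (c i)) + Ci * RtoC (Im (c i))).
  - now apply has_sum_plus, has_sum_scal.
  - extensionality i; destruct (c i) as [a b].
    unfold Cplus, Cmult, Ci, RtoC; simpl; f_equal; ring.
Qed.

Lemma tsum_spec {I} (c : I -> C) : summable c -> has_sum c (tsum c).
Proof.
  intros H; exact (epsilon_spec (inhabits (RtoC 0)) (has_sum c) (summable_has_sum c H)).
Qed.

Lemma tsum_eq {I} (c : I -> C) l : has_sum c l -> tsum c = l.
Proof.
  intros H; apply (has_sum_unique c); auto.
  exact (epsilon_spec (inhabits (RtoC 0)) (has_sum c) (ex_intro _ l H)).
Qed.

Lemma tsum_finite {I} (c : I -> C) (L0 : list I) :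
  NoDup L0 -> (forall i, ~ In i L0 -> c i = 0) -> tsum c = lsum c L0.
Proof. intros; now apply tsum_eq, has_sum_finite. Qed.

Lemma tsum_zero {I} (c : I -> C) : (forall i, c i = 0) -> tsum c = 0.
Proof. intros H; apply (tsum_finite c nil); auto; constructor. Qed.

Lemma tsum_scal {I} (k : C) (c : I -> C) :
  summable c -> tsum (fun i => k * c i) = k * tsum c.
Proof. intros H; apply tsum_eq, has_sum_scal, tsum_spec, H. Qed.

(** * Nonnegative families *)

Lemma Cmod_RtoC_Cmod (z : C) : Cmod (RtoC (Cmod z)) = Cmod z.
Proof. rewrite Cmod_R; apply Rabs_pos_eq, Cmod_ge_0. Qed.

(** Being a nonnegative real number, expressed inside [C] so that products
    and sums of such families need no conversion. *)
Definition nonnegative {I : Type} (c : I -> C) : Prop := forall i, RtoC (Cmod (c i)) = c i.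

Lemma nonnegative_Cmod {I} (c : I -> C) : nonnegative (fun i => RtoC (Cmod (c i))).
Proof. intros i; now rewrite Cmod_RtoC_Cmod. Qed.

Lemma nonnegative_mult {I} (c d : I -> C) :
  nonnegative c -> nonnegative d -> nonnegative (fun i => c i * d i).
Proof. intros Hc Hd i; now rewrite Cmod_mult, RtoC_mult, Hc, Hd. Qed.

Lemma summable_Cmod {I} (c : I -> C) :
  summable c <-> summable (fun i => RtoC (Cmod (c i))).
Proof.
  split; apply summable_le; intros i; rewrite Cmod_RtoC_Cmod; apply Rle_refl.
Qed.

Lemma lsum_nonnegative {I} (d : I -> C) L : nonnegative d -> lsum d L = RtoC (lsumR (modulus d) L).
Proof.
  intros Hd; rewrite <- lsum_RtoC; unfold modulus; f_equal; extensionality i; now rewrite Hd.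
Qed.

Lemma Cmod_lsum_le {I} (c d : I -> C) L :
  (forall i, Cmod (c i) <= Cmod (d i))%R -> (Cmod (lsum c L) <= lsumR (modulus d) L)%R.
Proof.
  intros Hle; induction L as [|i L IH]; simpl; [rewrite Cmod_0; lra|].
  assert (T := Cmod_triangle (c i) (lsum c L)); specialize (Hle i).
  unfold modulus at 1; lra.
Qed.

(** Enlarging the finite set only increases the sum of a nonnegative family, so
    no finite sum can exceed the limit. *)
Lemma lsumR_le_has_sum {I} (d : I -> C) (l : C) L :
  nonnegative d -> has_sum d l -> NoDup L -> (lsumR (modulus d) L <= Cmod l)%R.
Proof.
  intros Hd H HL; apply Rnot_lt_le; intros Hlt.
  assert (P : (0 < lsumR (modulus d) L - Cmod l)%R) by lra.
  destruct (H (mkposreal _ P)) as [L0 K].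
  set (L1 := nodup eq_dec_of (L ++ L0)).
  assert (H1 : NoDup L1) by apply NoDup_nodup.
  assert (Hi : forall i, In i (L ++ L0) -> In i L1) by (intros; now apply nodup_In).
  specialize (K L1 H1 (fun i H => Hi i (in_or_app _ _ _ (or_intror H)))); simpl in K.
  rewrite lsum_nonnegative in K by assumption.
  assert (lsumR (modulus d) L <= lsumR (modulus d) L1)%R.
  { apply lsumR_incl; auto using modulus_ge0; intros i Hin _; apply Hi, in_or_app; auto. }
  assert (T := Cmod_triangle (RtoC (lsumR (modulus d) L1) - l) l).
  replace (RtoC (lsumR (modulus d) L1) - l + l)
    with (RtoC (lsumR (modulus d) L1)) in T by ring.
  rewrite Cmod_R in T; assert (T' := Rle_abs (lsumR (modulus d) L1)); lra.
Qed.

Lemma has_sum_nonnegative_summable {I} (d : I -> C) l : nonnegative d -> has_sum d l -> summable d.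
Proof. intros Hd H; exists (Cmod l); intros L HL; now apply lsumR_le_has_sum. Qed.

Lemma Cmod_tsum_le {I} (c d : I -> C) :
  (forall i, Cmod (c i) <= Cmod (d i))%R -> nonnegative d -> summable d ->
  (Cmod (tsum c) <= Cmod (tsum d))%R.
Proof.
  intros Hle Hd Sd.
  assert (Sc := tsum_spec _ (summable_le _ _ Hle Sd)).
  apply tsum_spec in Sd.
  apply Rnot_lt_le; intros Hlt.
  assert (P : (0 < Cmod (tsum c) - Cmod (tsum d))%R) by lra.
  destruct (Sc (mkposreal _ P)) as [L0 K].
  set (L1 := nodup eq_dec_of L0).
  assert (H1 : NoDup L1) by apply NoDup_nodup.
  specialize (K L1 H1 (fun i H => proj2 (nodup_In _ _ _) H)); simpl in K.
  assert (B := lsumR_le_has_sum _ _ L1 Hd Sd H1).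
  assert (A := Cmod_lsum_le c d L1 Hle).
  assert (T := Cmod_triangle (lsum c L1) (- (lsum c L1 - tsum c))).
  rewrite Cmod_opp in T.
  replace (lsum c L1 + - (lsum c L1 - tsum c)) with (tsum c) in T by ring.
  lra.
Qed.

Lemma Cmod_le_tsum {I} (d : I -> C) i :
  nonnegative d -> summable d -> (Cmod (d i) <= Cmod (tsum d))%R.
Proof.
  intros Hd Sd.
  assert (H := lsumR_le_has_sum _ _ (i :: nil) Hd (tsum_spec _ Sd)).
  simpl in H; unfold modulus in H; rewrite Rplus_0_r in H; apply H.
  constructor; [intros [] | constructor].
Qed.

(** The limit of nonnegative real finite sums is a nonnegative real; a negative
    limit would be missed by every finite sum. *)
Lemma tsum_nonnegative {I} (d : I -> C) :
  nonnegative d -> summable d -> RtoC (Cmod (tsum d)) = tsum d.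
Proof.
  intros Hd [M HM].
  destruct (has_sum_nonnegative_bounded (modulus d) M) as [s Hs]; auto using modulus_ge0.
  assert (E : (fun i => RtoC (modulus d i)) = d) by (extensionality i; apply Hd).
  rewrite E in Hs; rewrite (tsum_eq _ _ Hs), Cmod_R; f_equal; apply Rabs_pos_eq.
  apply Rnot_lt_le; intros Hneg.
  assert (P : (0 < - s)%R) by lra.
  destruct (Hs (mkposreal _ P)) as [L0 K].
  set (L1 := nodup eq_dec_of L0).
  specialize (K L1 (NoDup_nodup _ _) (fun i H => proj2 (nodup_In _ _ _) H)); simpl in K.
  rewrite lsum_nonnegative, <- RtoC_minus, Cmod_R in K by assumption.
  assert (H := lsumR_ge0 (modulus d) L1 (modulus_ge0 d)).
  rewrite Rabs_pos_eq in K; lra.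
Qed.

(** * Reindexing and double sums *)

Lemma has_sum_bij {I J} (phi : J -> I) (psi : I -> J) (c : I -> C) l :
  (forall j, psi (phi j) = j) -> (forall i, phi (psi i) = i) ->
  has_sum c l -> has_sum (fun j => c (phi j)) l.
Proof.
  intros H1 H2 H eps; destruct (H eps) as [L0 K].
  exists (map psi L0); intros L HL Hinc.
  rewrite <- lsum_map; apply K.
  - apply Injective_map_NoDup; auto; intros x y E; rewrite <- (H1 x), E; auto.
  - intros i Hi; rewrite <- (H2 i); now apply in_map, Hinc, in_map.
Qed.

Lemma summable_inj {I J} (phi : J -> I) (c : I -> C) :
  (forall j j', phi j = phi j' -> j = j') ->
  summable c -> summable (fun j => c (phi j)).
Proof.
  intros Hphi [M HM]; exists M; intros L HL.
  change (modulus (fun j => c (phi j))) with (fun j => modulus c (phi j)).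
  rewrite <- lsumR_map; apply HM; now apply Injective_map_NoDup.
Qed.

Lemma tsum_bij {I J} (phi : J -> I) (psi : I -> J) (c : I -> C) :
  (forall j, psi (phi j) = j) -> (forall i, phi (psi i) = i) ->
  summable c -> tsum (fun j => c (phi j)) = tsum c.
Proof. intros H1 H2 H; apply tsum_eq, (has_sum_bij phi psi); auto using tsum_spec. Qed.

Definition pair_family {I J K : Type} (c : I -> J -> K) (x : I * J) : K := c (fst x) (snd x).

Lemma summable_row {I J} (c : I -> J -> C) i : summable (pair_family c) -> summable (c i).
Proof. apply (summable_inj (fun j => (i, j)) (pair_family c)); congruence. Qed.

(** A finite sum of limits, needed to let the columns of a double family fill up
    while finitely many rows are fixed. *)
Lemma has_sum_lsum {I J} (c : I -> J -> C) (r : I -> C) L :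
  (forall i, has_sum (c i) (r i)) -> has_sum (fun j => lsum (fun i => c i j) L) (lsum r L).
Proof.
  intros H; induction L as [|i L IH]; simpl.
  - apply (has_sum_finite (fun _ : J => 0) nil); auto; constructor.
  - now apply has_sum_plus.
Qed.

(** Fubini for unconditional convergence. Fix finitely many rows containing those
    that matter for [eps]; enlarge the finite set of columns until the finite
    rectangle is close both to [l] and to the sum of the selected row sums. *)
Lemma has_sum_rows {I J} (c : I -> J -> C) (r : I -> C) l :
  (forall i, has_sum (c i) (r i)) -> has_sum (pair_family c) l -> has_sum r l.
Proof.
  intros Hr Hl eps.
  destruct (Hl (pos_div_2 eps)) as [L0 K0].
  exists (map fst L0); intros L HL Hinc.
  (* The rows in [L] are now fixed; [L1] are the columns that complete them up to [eps / 2]. *)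
  destruct (has_sum_lsum c r L Hr (pos_div_2 eps)) as [L1 K1].
  set (L2 := nodup eq_dec_of (L1 ++ map snd L0)).
  assert (H2 : NoDup L2) by apply NoDup_nodup.
  assert (Hi : forall i, In i (L1 ++ map snd L0) -> In i L2) by (intros; now apply nodup_In).
  specialize (K1 L2 H2 (fun i H => Hi i (in_or_app _ _ _ (or_introl H)))).
  specialize (K0 (list_prod L L2) (NoDup_prod _ _ HL H2)).
  rewrite lsum_prod in K0; unfold pair_family in K0; simpl in K0, K1.
  rewrite lsum_exchange in K0.
  assert (K : (Cmod (lsum (fun j => lsum (fun i => c i j) L) L2 - l) < eps / 2)%R).
  { apply K0; intros [i j] Hij; apply in_prod.
    - apply Hinc, (in_map fst _ _ Hij).
    - apply Hi, in_or_app; right; apply (in_map snd _ _ Hij). }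
  set (t := lsum (fun j => lsum (fun i => c i j) L) L2) in *.
  assert (T := Cmod_triangle (t - l) (- (t - lsum r L))).
  rewrite Cmod_opp in T.
  replace (t - l + - (t - lsum r L)) with (lsum r L - l) in T by ring.
  lra.
Qed.

(** The row sums are dominated by the row sums of the moduli, and the latter form
    a nonnegative family that has a sum. *)
Lemma summable_rows {I J} (c : I -> J -> C) :
  summable (pair_family c) -> summable (fun i => tsum (c i)).
Proof.
  intros H.
  set (d := fun i j => RtoC (Cmod (c i j))).
  assert (Hd : summable (pair_family d)) by now apply (summable_Cmod (pair_family c)).
  assert (Nd : forall i, nonnegative (d i)) by (intros i; apply nonnegative_Cmod).
  assert (Sd : forall i, summable (d i)) by (intros i; now apply summable_row).
  apply summable_le with (fun i => tsum (d i)).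
  - intros i; apply Cmod_tsum_le; auto.
    intros j; unfold d; rewrite Cmod_RtoC_Cmod; apply Rle_refl.
  - apply has_sum_nonnegative_summable with (tsum (pair_family d)).
    + intros i; now apply tsum_nonnegative.
    + apply (has_sum_rows d); auto using tsum_spec.
Qed.

Lemma tsum_rows {I J} (c : I -> J -> C) :
  summable (pair_family c) -> tsum (fun i => tsum (c i)) = tsum (pair_family c).
Proof.
  intros H; apply tsum_eq, (has_sum_rows c); auto using tsum_spec, summable_row.
Qed.

(** Tonelli: every finite set of pairs lies in a finite rectangle, whose sum is
    bounded by a finite sum of row sums. *)
Lemma summable_pair_family {I J} (c : I -> J -> C) :
  (forall i, summable (c i)) ->
  summable (fun i => tsum (fun j => RtoC (Cmod (c i j)))) ->
  summable (pair_family c).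
Proof.
  intros Hrow [M HM]; exists M; intros L HL.
  set (L1 := nodup eq_dec_of (map fst L)); set (L2 := nodup eq_dec_of (map snd L)).
  assert (H1 : NoDup L1) by apply NoDup_nodup.
  assert (H2 : NoDup L2) by apply NoDup_nodup.
  apply Rle_trans with (lsumR (modulus (pair_family c)) (list_prod L1 L2)).
  - apply lsumR_incl; auto using modulus_ge0.
    intros [i j] Hij _; apply in_prod; apply nodup_In;
      [apply (in_map fst _ _ Hij) | apply (in_map snd _ _ Hij)].
  - rewrite lsumR_prod; apply Rle_trans with (2 := HM L1 H1), lsumR_le; intros i.
    apply Rle_trans with (lsumR (modulus (fun j => RtoC (Cmod (c i j)))) L2).
    + right; f_equal; extensionality j; unfold modulus, pair_family; simpl.
      now rewrite Cmod_RtoC_Cmod.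
    + apply lsumR_le_has_sum; [apply nonnegative_Cmod | | exact H2].
      apply tsum_spec; now apply (summable_Cmod (c i)).
Qed.

Lemma summable_swap {I J} (c : I -> J -> C) :
  summable (pair_family c) -> summable (pair_family (fun j i => c i j)).
Proof.
  apply (summable_inj (fun x : J * I => (snd x, fst x)) (pair_family c)).
  intros [] [] E; simpl in E; congruence.
Qed.

Lemma tsum_exchange {I J} (c : I -> J -> C) :
  summable (pair_family c) ->
  tsum (fun i => tsum (c i)) = tsum (fun j => tsum (fun i => c i j)).
Proof.
  intros H; rewrite tsum_rows, (tsum_rows (fun j i => c i j)); auto using summable_swap.
  symmetry.
  apply (tsum_bij (fun x : J * I => (snd x, fst x)) (fun x => (snd x, fst x)) (pair_family c));
    auto; now intros [].
Qed.

Lemma summable_tensor {I J} (u : I -> C) (v : J -> C) :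
  summable u -> summable v -> summable (pair_family (fun i j => u i * v j)).
Proof.
  intros Hu Hv; apply summable_pair_family.
  - intros i; now apply summable_scal.
  - replace (fun i => tsum (fun j => RtoC (Cmod (u i * v j)))) with
      (fun i => tsum (fun j => RtoC (Cmod (v j))) * RtoC (Cmod (u i))).
    + apply (summable_scal _ (fun i => RtoC (Cmod (u i)))); now apply (summable_Cmod u).
    + extensionality i; rewrite Cmult_comm, <- tsum_scal.
      * f_equal; extensionality j; now rewrite Cmod_mult, RtoC_mult.
      * now apply (summable_Cmod v).
Qed.

Lemma tsum_tensor {I J} (u : I -> C) (v : J -> C) :
  summable u -> summable v -> tsum (pair_family (fun i j => u i * v j)) = tsum u * tsum v.
Proof.
  intros Hu Hv; rewrite <- tsum_rows by now apply summable_tensor.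
  rewrite Cmult_comm, <- tsum_scal by assumption.
  f_equal; extensionality i; rewrite tsum_scal; auto; ring.
Qed.

(** * One-sided and two-sided series *)

Lemma sum_n_lsum (c : nat -> C) N : sum_n c N = lsum c (seq 0 (S N)).
Proof.
  induction N as [|N IH].
  - rewrite sum_O; simpl; ring.
  - rewrite sum_Sn, IH, (seq_S (S N)), lsum_app; simpl.
    unfold plus; simpl; ring.
Qed.

Lemma is_series_Cmod (c : nat -> C) (l : C) :
  is_series c l <->
  forall eps : posreal, exists N, forall n, (N <= n)%nat ->
    (Cmod (lsum c (seq 0 (S n)) - l) < eps)%R.
Proof.
  unfold is_series; rewrite (filterlim_locally_ball_norm (U := C_NormedModule)).
  split; intros H eps; destruct (H eps) as [N K]; exists N; intros n Hn;
    specialize (K n Hn).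
  - rewrite <- sum_n_lsum; exact K.
  - rewrite <- sum_n_lsum in K; exact K.
Qed.

Lemma is_series_tsum (c : nat -> C) : summable c -> is_series c (tsum c).
Proof.
  intros H; apply is_series_Cmod; intros eps.
  destruct (tsum_spec _ H eps) as [L0 K].
  exists (list_max L0); intros n Hn; apply K; [apply seq_NoDup|].
  intros i Hi; apply in_seq.
  assert (Hm := proj1 (list_max_le L0 _) (le_n _)).
  rewrite Forall_forall in Hm; specialize (Hm i Hi); lia.
Qed.

(** A finite set of indices lies in an initial segment, and the partial sums over
    initial segments increase to their limit, hence stay below [|l| + 1]. *)
Lemma is_series_nonnegative_summable (c : nat -> C) (l : C) :
  nonnegative c -> is_series c l -> summable c.
Proof.
  intros Hc H; destruct (proj1 (is_series_Cmod c l) H (mkposreal 1 Rlt_0_1)) as [N K].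
  exists (Cmod l + 1)%R; intros L HL.
  set (n := Nat.max N (list_max L)).
  apply Rle_trans with (lsumR (modulus c) (seq 0 (S n))).
  - apply lsumR_incl; auto using modulus_ge0; intros i Hi _; apply in_seq.
    assert (Hm := proj1 (list_max_le L _) (le_n _)).
    rewrite Forall_forall in Hm; specialize (Hm i Hi); lia.
  - assert (Kn := K n (Nat.le_max_l _ _)); cbn [pos] in Kn.
    rewrite lsum_nonnegative in Kn by assumption.
    set (s := lsumR (modulus c) (seq 0 (S n))) in *.
    assert (T := Cmod_triangle (RtoC s - l) l).
    replace (RtoC s - l + l) with (RtoC s) in T by ring.
    rewrite Cmod_R in T; assert (T' := Rle_abs s); lra.
Qed.

Lemma is_series_C_unique (c : nat -> C) (l1 l2 : C) : is_series c l1 -> is_series c l2 -> l1 = l2.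
Proof. exact (filterlim_locally_unique (V := C_NormedModule) (sum_n c) l1 l2). Qed.

(** Together with [signed_of_Z], a bijection of [bool * nat] with [Z] matching
    the splitting of a two-sided series; the index of the negative half is
    shifted so that zero is not counted twice. *)
Definition Z_of_signed (b : bool) (n : nat) : Z :=
  if b then Z.of_nat n else (- Z.of_nat (S n))%Z.

Definition signed_of_Z (z : Z) : bool * nat :=
  if Z_lt_dec z 0 then (false, Z.to_nat (- z - 1)) else (true, Z.to_nat z).

Lemma signed_of_ZK z : pair_family Z_of_signed (signed_of_Z z) = z.
Proof.
  unfold signed_of_Z, pair_family; destruct (Z_lt_dec z 0); cbn [fst snd];
    unfold Z_of_signed; lia.
Qed.

Lemma Z_of_signedK x : signed_of_Z (pair_family Z_of_signed x) = x.
Proof.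
  destruct x as [[] n]; unfold pair_family, signed_of_Z, Z_of_signed; cbn [fst snd];
    destruct Z_lt_dec; try lia; f_equal; lia.
Qed.

(** Fubini for the family over [bool * nat], the sum over [bool] being the sum of
    the two one-sided series. *)
Lemma is_sumZ_tsum (c : Z -> C) : summable c -> is_sumZ c (tsum c).
Proof.
  intros H.
  set (d := fun b n => c (Z_of_signed b n)).
  assert (Hd : summable (pair_family d)).
  { apply (summable_inj (pair_family Z_of_signed) c); auto.
    intros x y E; now rewrite <- (Z_of_signedK x), E, Z_of_signedK. }
  exists (tsum (d false)), (tsum (d true)); split; [|split].
  - exact (is_series_tsum _ (summable_row _ false Hd)).
  - exact (is_series_tsum _ (summable_row _ true Hd)).
  - transitivity (tsum (pair_family d)).
    + symmetry; apply (tsum_bij (pair_family Z_of_signed) signed_of_Z c);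
        auto using signed_of_ZK, Z_of_signedK.
    + rewrite <- tsum_rows by assumption.
      rewrite (tsum_finite _ (false :: true :: nil)); [simpl; ring | |].
      * repeat constructor; simpl; intuition discriminate.
      * intros [] Hb; destruct Hb; simpl; auto.
Qed.

Lemma is_sumZ_unique (c : Z -> C) l1 l2 : is_sumZ c l1 -> is_sumZ c l2 -> l1 = l2.
Proof.
  intros (n1 & p1 & N1 & P1 & ->) (n2 & p2 & N2 & P2 & ->).
  now rewrite (is_series_C_unique _ _ _ N1 N2), (is_series_C_unique _ _ _ P1 P2).
Qed.

Lemma is_sumZ_nonnegative_summable (c : Z -> C) l : nonnegative c -> is_sumZ c l -> summable c.
Proof.
  intros Hc (ln & lp & Hn & Hp & _).
  destruct (is_series_nonnegative_summable _ _ (fun n => Hc _) Hn) as [M1 K1].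
  destruct (is_series_nonnegative_summable _ _ (fun n => Hc _) Hp) as [M2 K2].
  exists (M1 + M2)%R; intros L HL.
  set (S := seq 0 (Datatypes.S (list_max (map Z.abs_nat L)))).
  specialize (K1 S (seq_NoDup _ _)); specialize (K2 S (seq_NoDup _ _)).
  apply Rle_trans with
    (lsumR (modulus c) (map (fun n => - Z.of_nat (Datatypes.S n))%Z S ++ map Z.of_nat S)).
  - apply lsumR_incl; auto using modulus_ge0; intros z Hz _; apply in_or_app.
    assert (Hm := proj1 (list_max_le (map Z.abs_nat L) _) (le_n _)).
    rewrite Forall_forall in Hm; specialize (Hm _ (in_map Z.abs_nat _ _ Hz)).
    destruct (Z_lt_dec z 0) as [Hneg|Hpos]; [left|right]; apply in_map_iff.
    + exists (Z.to_nat (- z - 1)); split; [lia | apply in_seq; lia].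
    + exists (Z.to_nat z); split; [lia | apply in_seq; lia].
  - rewrite lsumR_app, 2!lsumR_map.
    apply Rplus_le_compat; [exact K1 | exact K2].
Qed.

Lemma is_series_is_sumZ (c : Z -> C) (l : C) :
  (forall z, (z < 0)%Z -> c z = 0) ->
  is_series (fun n => c (Z.of_nat n)) l -> is_sumZ c l.
Proof.
  intros Hneg H; exists 0, l; split; [|split].
  - apply is_series_Cmod; intros eps; exists 0%nat; intros n _.
    rewrite lsum_zero by (intros; apply Hneg; lia).
    replace (0 - 0) with (RtoC 0) by ring; rewrite Cmod_0; apply cond_pos.
  - exact H.
  - ring.
Qed.

Lemma is_series_tsumZ (c : Z -> C) :
  (forall z, (z < 0)%Z -> c z = 0) -> summable c ->
  is_series (fun n => c (Z.of_nat n)) (tsum c).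
Proof.
  intros Hneg H.
  assert (S : summable (fun n => c (Z.of_nat n))) by (apply (summable_inj Z.of_nat); auto; lia).
  assert (E := is_series_tsum _ S).
  rewrite (is_sumZ_unique c (tsum c) _ (is_sumZ_tsum c H) (is_series_is_sumZ c _ Hneg E)); exact E.
Qed.

(** * Products and their associativity *)

Definition conv (g f : laurent) : laurent := fun n => tsum (fun m => g m * f (n - m)%Z).

(** Existence of the product with absolutely convergent coefficients; for
    nonnegative series this is the same as existence of the product. *)
Definition conv_summable (g f : laurent) : Prop :=
  forall n, summable (fun m => g m * f (n - m)%Z).

Lemma conv_summable_is_prod g f : conv_summable g f -> is_prod g f (conv g f).
Proof. intros H n; apply is_sumZ_tsum, H. Qed.

Lemma nonnegative_term g f n :
  nonnegative g -> nonnegative f -> nonnegative (fun m : Z => g m * f (n - m)%Z).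
Proof. intros Hg Hf; apply nonnegative_mult; auto; intros m; apply Hf. Qed.

Lemma nonnegative_conv g f :
  nonnegative g -> nonnegative f -> conv_summable g f -> nonnegative (conv g f).
Proof. intros Hg Hf H n; apply tsum_nonnegative; auto using nonnegative_term. Qed.

Lemma is_prod_conv_summable g f p :
  nonnegative g -> nonnegative f -> is_prod g f p -> conv_summable g f /\ p = conv g f.
Proof.
  intros Hg Hf H.
  assert (K : conv_summable g f)
    by (intros n; apply (is_sumZ_nonnegative_summable _ (p n)); auto using nonnegative_term).
  split; auto; extensionality n; apply (is_sumZ_unique _ _ _ (H n)), is_sumZ_tsum, K.
Qed.

Lemma conv_one_l f : conv_summable laurent_one f /\ conv laurent_one f = f.
Proof.
  assert (Hz : forall n m, ~ In m (0%Z :: nil) -> laurent_one m * f (n - m)%Z = 0).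
  { intros n m Hm; unfold laurent_one; destruct Z.eq_dec; [|ring].
    subst; simpl in Hm; tauto. }
  split.
  - intros n; apply (summable_finite _ (0%Z :: nil)), Hz.
  - extensionality n; unfold conv; rewrite (tsum_finite _ (0%Z :: nil)).
    + simpl; rewrite Z.sub_0_r; unfold laurent_one; simpl; ring.
    + repeat constructor; auto.
    + apply Hz.
Qed.

Lemma conv_one_r f : conv_summable f laurent_one /\ conv f laurent_one = f.
Proof.
  assert (Hz : forall n m, ~ In m (n :: nil) -> f m * laurent_one (n - m)%Z = 0).
  { intros n m Hm; unfold laurent_one; destruct Z.eq_dec; [|ring].
    elim Hm; left; lia. }
  split.
  - intros n; apply (summable_finite _ (n :: nil)), Hz.
  - extensionality n; unfold conv; rewrite (tsum_finite _ (n :: nil)).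
    + simpl; rewrite Z.sub_diag; unfold laurent_one; simpl; ring.
    + repeat constructor; auto.
    + apply Hz.
Qed.

(** Coefficient [n] of the product of three series is the sum of this family;
    the two ways of bracketing are its two iterated sums. *)
Definition triple (A B D : laurent) (n : Z) : Z -> Z -> C :=
  fun m j => A m * (B j * D (n - m - j)%Z).

(** Tonelli, with the rows indexed by the position in [A]. *)
Lemma summable_triple_l A B D n :
  nonnegative A -> nonnegative B -> nonnegative D ->
  conv_summable B D -> conv_summable A (conv B D) ->
  summable (pair_family (triple A B D n)).
Proof.
  intros HA HB HD H1 H2; apply summable_pair_family.
  - intros m; apply summable_scal, H1.
  - apply summable_le with (2 := H2 n); intros m.
    right; f_equal; unfold conv, triple; rewrite <- tsum_scal by apply H1.
    f_equal; extensionality j.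
    now rewrite !Cmod_mult, !RtoC_mult, HA, HB, HD.
Qed.

Lemma conv_triple_l A B D :
  (forall n, summable (pair_family (triple A B D n))) -> conv_summable B D ->
  conv_summable A (conv B D) /\ forall n, conv A (conv B D) n = tsum (pair_family (triple A B D n)).
Proof.
  intros H H1.
  assert (E : forall n, (fun m => A m * conv B D (n - m)%Z) = fun m => tsum (triple A B D n m)).
  { intros n; extensionality m; unfold triple, conv.
    now rewrite (tsum_scal (A m)) by apply H1. }
  split; intros n; [|unfold conv at 1]; rewrite E.
  - now apply summable_rows.
  - now apply tsum_rows.
Qed.

(** The change of variables from (sum of the two indices, first index) to
    the pair of indices. *)
Definition shear (x : Z * Z) : Z * Z := (snd x, fst x - snd x)%Z.
Definition unshear (x : Z * Z) : Z * Z := (fst x + snd x, fst x)%Z.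

Lemma shearK x : unshear (shear x) = x.
Proof. destruct x; unfold shear, unshear; simpl; f_equal; lia. Qed.

Lemma unshearK x : shear (unshear x) = x.
Proof. destruct x; unfold shear, unshear; simpl; f_equal; lia. Qed.

Lemma shear_inj x y : shear x = shear y -> x = y.
Proof. intros E; now rewrite <- (shearK x), E, shearK. Qed.

Lemma unshear_inj x y : unshear x = unshear y -> x = y.
Proof. intros E; now rewrite <- (unshearK x), E, unshearK. Qed.

Definition diagonals (c : Z -> Z -> C) : Z -> Z -> C := fun s k => c k (s - k)%Z.

Lemma summable_diagonals c : summable (pair_family (diagonals c)) <-> summable (pair_family c).
Proof.
  split; intros H.
  - replace (pair_family c) with (fun x => pair_family (diagonals c) (unshear x)).
    + now apply summable_inj; [apply unshear_inj|].
    + extensionality x; destruct x as [k l]; unfold pair_family, diagonals, unshear; simpl.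
      f_equal; lia.
  - exact (summable_inj shear (pair_family c) shear_inj H).
Qed.

Lemma tsum_diagonals c :
  summable (pair_family c) -> tsum (pair_family (diagonals c)) = tsum (pair_family c).
Proof. exact (tsum_bij shear unshear (pair_family c) shearK unshearK). Qed.

Lemma diagonals_triple A B D n s :
  diagonals (triple A B D n) s = fun m => D (n - s)%Z * (A m * B (s - m)%Z).
Proof.
  extensionality m; unfold diagonals, triple.
  replace (n - m - (s - m))%Z with (n - s)%Z by lia; ring.
Qed.

(** Tonelli along the diagonals, whose sums are the terms of the product of
    [conv A B] with [D]. *)
Lemma summable_triple_r A B D n :
  nonnegative A -> nonnegative B -> nonnegative D ->
  conv_summable A B -> conv_summable (conv A B) D ->
  summable (pair_family (triple A B D n)).
Proof.
  intros HA HB HD H1 H2; apply summable_diagonals, summable_pair_family.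
  - intros s; rewrite diagonals_triple; apply summable_scal, H1.
  - apply summable_le with (2 := H2 n); intros s.
    right; f_equal; rewrite diagonals_triple, Cmult_comm.
    unfold conv; rewrite <- tsum_scal by apply H1.
    f_equal; extensionality j.
    now rewrite !Cmod_mult, !RtoC_mult, HA, HB, HD.
Qed.

Lemma conv_triple_r A B D :
  (forall n, summable (pair_family (triple A B D n))) -> conv_summable A B ->
  conv_summable (conv A B) D /\ forall n, conv (conv A B) D n = tsum (pair_family (triple A B D n)).
Proof.
  intros H H1.
  assert (E : forall n, (fun s => conv A B s * D (n - s)%Z)
                        = fun s => tsum (diagonals (triple A B D n) s)).
  { intros n; extensionality s; rewrite diagonals_triple, tsum_scal by apply H1.
    apply Cmult_comm. }
  split; intros n; [|unfold conv at 1]; rewrite E.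
  - now apply summable_rows, summable_diagonals.
  - rewrite tsum_rows by now apply summable_diagonals.
    now apply tsum_diagonals.
Qed.

(** * Powers *)

Fixpoint lpow (f : laurent) (k : nat) : laurent :=
  match k with O => laurent_one | S k' => conv (lpow f k') f end.

(** All products in the recursion that leads to the power [k] exist. *)
Definition pow_summable (f : laurent) (k : nat) : Prop :=
  forall j, (j < k)%nat -> conv_summable (lpow f j) f.

Lemma pow_summable_le f k l : (k <= l)%nat -> pow_summable f l -> pow_summable f k.
Proof. intros Hkl H j Hj; apply H; lia. Qed.

Lemma lpow_1 f : lpow f 1 = f.
Proof. apply conv_one_l. Qed.

Lemma pow_summable_is_pow f k : pow_summable f k -> is_pow f k (lpow f k).
Proof.
  induction k as [|[|k] IH]; intros H.
  - reflexivity.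
  - apply lpow_1.
  - exists (lpow f (S k)); split.
    + apply IH; revert H; apply pow_summable_le; lia.
    + apply conv_summable_is_prod, H; lia.
Qed.

Lemma nonnegative_one : nonnegative laurent_one.
Proof. intros n; unfold laurent_one; destruct Z.eq_dec; now rewrite ?Cmod_1, ?Cmod_0. Qed.

Lemma nonnegative_lpow f k : nonnegative f -> pow_summable f k -> nonnegative (lpow f k).
Proof.
  intros Hf; induction k as [|k IH]; intros H; [apply nonnegative_one|].
  apply nonnegative_conv; auto; apply IH; revert H; apply pow_summable_le; lia.
Qed.

Lemma is_pow_pow_summable f k p : nonnegative f -> is_pow f k p -> pow_summable f k /\ p = lpow f k.
Proof.
  intros Hf; revert p; induction k as [|[|k] IH]; intros p H.
  - split; [intros j Hj; lia | exact H].
  - split; [|now rewrite lpow_1].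
    intros j Hj; replace j with 0%nat by lia; apply conv_one_l.
  - destruct H as (q & Hq & Hp); destruct (IH q Hq) as [Ok ->].
    apply is_prod_conv_summable in Hp as [K ->]; auto using nonnegative_lpow.
    split; [|reflexivity].
    intros j Hj; destruct (Nat.eq_dec j (S k)) as [->|]; [exact K | apply Ok; lia].
Qed.

Lemma conv_summable_le g f g' f' :
  (forall n, Cmod (g n) <= Cmod (g' n))%R -> (forall n, Cmod (f n) <= Cmod (f' n))%R ->
  conv_summable g' f' -> conv_summable g f.
Proof.
  intros Hg Hf H n; apply summable_le with (2 := H n); intros m.
  rewrite !Cmod_mult; apply Rmult_le_compat; auto using Cmod_ge_0.
Qed.

(** The triangle inequality, and dominated existence of the next product. *)
Lemma lpow_le f k :
  pow_summable (laurent_abs f) k ->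
  pow_summable f k /\ forall n, (Cmod (lpow f k n) <= Cmod (lpow (laurent_abs f) k n))%R.
Proof.
  assert (Hf : forall n, (Cmod (f n) <= Cmod (laurent_abs f n))%R)
    by (intros n; unfold laurent_abs; rewrite Cmod_RtoC_Cmod; apply Rle_refl).
  assert (Nf : nonnegative (laurent_abs f)) by apply nonnegative_Cmod.
  induction k as [|k IH]; intros H; [split; [intros j Hj; lia | intros; apply Rle_refl]|].
  assert (H' : pow_summable (laurent_abs f) k) by (revert H; apply pow_summable_le; lia).
  assert (Hk : conv_summable (lpow (laurent_abs f) k) (laurent_abs f)) by (apply H; lia).
  destruct (IH H') as [Ok Le]; split.
  - intros j Hj; destruct (Nat.eq_dec j k) as [->|]; [|apply Ok; lia].
    apply conv_summable_le with (3 := Hk); auto.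
  - intros n; apply Cmod_tsum_le.
    + intros m; rewrite !Cmod_mult; apply Rmult_le_compat; auto using Cmod_ge_0.
    + apply nonnegative_term; auto using nonnegative_lpow.
    + apply Hk.
Qed.

Lemma summable_triple_le A B D A' B' D' n :
  (forall n, Cmod (A n) <= Cmod (A' n))%R -> (forall n, Cmod (B n) <= Cmod (B' n))%R ->
  (forall n, Cmod (D n) <= Cmod (D' n))%R ->
  summable (pair_family (triple A' B' D' n)) -> summable (pair_family (triple A B D n)).
Proof.
  intros HA HB HD; apply summable_le; intros [m j]; unfold pair_family, triple; simpl.
  rewrite !Cmod_mult; repeat apply Rmult_le_compat; auto using Cmod_ge_0, Rmult_le_pos.
Qed.

(** Induction on [l]: the rebracketing
    [f^k (f^l f) = (f^k f^l) f] is legitimate when the triple family is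
    summable. *)
Lemma lpow_add_of_triples f k l :
  pow_summable f l ->
  (forall j, (j < l)%nat -> forall n, summable (pair_family (triple (lpow f k) (lpow f j) f n))) ->
  conv_summable (lpow f k) (lpow f l) /\ conv (lpow f k) (lpow f l) = lpow f (k + l).
Proof.
  induction l as [|l IH]; intros Hl T.
  - rewrite Nat.add_0_r; apply conv_one_r.
  - destruct IH as [Ok E]; [revert Hl; apply pow_summable_le; lia | intros; apply T; lia |].
    destruct (conv_triple_l _ _ _ (T l (Nat.lt_succ_diag_r l)) (Hl l (Nat.lt_succ_diag_r l)))
      as [Ok' E1].
    destruct (conv_triple_r _ _ _ (T l (Nat.lt_succ_diag_r l)) Ok) as [_ E2].
    split; [exact Ok'|].
    rewrite Nat.add_succ_r; extensionality n; simpl; rewrite <- E.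
    now rewrite E2, <- E1.
Qed.

(** For a nonnegative series, existence of [a^(k+j+1) = (a^k a^j) a] is what
    makes the triple family for [a^k], [a^j], [a] summable.  This has to be
    interleaved with the law of exponents, which identifies [a^k a^j]. *)
Lemma lpow_triples a k l :
  nonnegative a -> pow_summable a (k + l) ->
  forall j, (j < l)%nat -> forall n, summable (pair_family (triple (lpow a k) (lpow a j) a n)).
Proof.
  intros Ha; induction l as [|l IH]; intros H j Hj; [lia|].
  assert (Hk : pow_summable a k) by (revert H; apply pow_summable_le; lia).
  assert (Hl : pow_summable a l) by (revert H; apply pow_summable_le; lia).
  assert (Hkl : pow_summable a (k + l)) by (revert H; apply pow_summable_le; lia).
  destruct (Nat.eq_dec j l) as [->|]; [|apply IH; auto; lia].
  destruct (lpow_add_of_triples a k l Hl (IH Hkl)) as [Ok E].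
  intros n; apply summable_triple_r; auto using nonnegative_lpow.
  rewrite E; apply H; lia.
Qed.

(** Summability of the triple families is checked on moduli, where it holds
    by Tonelli. *)
Lemma lpow_add f k l :
  pow_summable (laurent_abs f) (k + l) ->
  conv_summable (lpow f k) (lpow f l) /\ conv (lpow f k) (lpow f l) = lpow f (k + l).
Proof.
  intros H.
  assert (Hk : pow_summable (laurent_abs f) k) by (revert H; apply pow_summable_le; lia).
  assert (Hl : pow_summable (laurent_abs f) l) by (revert H; apply pow_summable_le; lia).
  apply lpow_add_of_triples; [now apply lpow_le|]; intros j Hj n.
  apply summable_triple_le with (4 := lpow_triples _ k l (nonnegative_Cmod f) H j Hj n).
  - now apply lpow_le.
  - apply lpow_le; revert Hl; apply pow_summable_le; lia.
  - intros i; unfold laurent_abs; rewrite Cmod_RtoC_Cmod; apply Rle_refl.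
Qed.

Lemma laurent_abs_nonnegative a : nonnegative a -> laurent_abs a = a.
Proof. intros H; extensionality n; apply H. Qed.

(** By Tonelli [a^k (a^l a)] is a convergent triple sum; its diagonal at [s] is
    the defining sum of [(a^k a^l) s] multiplied by a coefficient of [a] that
    can be chosen nonzero.  So [a^k a^l] exists and induction applies. *)
Lemma pow_summable_add a k l :
  nonnegative a -> pow_summable a k -> pow_summable a l ->
  conv_summable (lpow a k) (lpow a l) -> pow_summable a (k + l).
Proof.
  intros Ha Hk; destruct (classic (exists i, a i <> 0)) as [[i Hi]|Hz].
  - induction l as [|l IH]; intros Hl H; [now rewrite Nat.add_0_r|].
    assert (Hl' : pow_summable a l) by (revert Hl; apply pow_summable_le; lia).
    assert (Hla : conv_summable (lpow a l) a) by (apply Hl; lia).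
    assert (T : forall n, summable (pair_family (triple (lpow a k) (lpow a l) a n))).
    { intros n; apply summable_triple_l; auto using nonnegative_lpow. }
    assert (Ok : conv_summable (lpow a k) (lpow a l)).
    { intros s.
      (* In the coefficient [s + i] of the triple product, the diagonal
         [s] carries the factor [a i]. *)
      assert (S := summable_row _ s (proj2 (summable_diagonals _) (T (s + i)%Z))).
      rewrite diagonals_triple in S.
      replace (s + i - s)%Z with i in S by lia.
      apply (summable_scal (/ a i)) in S; apply summable_le with (2 := S).
      intros m; right; f_equal; field; exact Hi. }
    assert (Hkl := IH Hl' Ok).
    rewrite <- (laurent_abs_nonnegative a Ha) in Hkl.
    assert (E := proj2 (lpow_add a k l Hkl)).
    rewrite (laurent_abs_nonnegative a Ha) in Hkl.
    intros j Hj; destruct (Nat.eq_dec j (k + l)) as [->|]; [|apply Hkl; lia].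
    rewrite <- E; now apply conv_triple_r.
  (* All products by the zero series exist. *)
  - intros _ _ j _ n; apply (summable_finite _ nil); intros m _.
    assert (E : a (n - m)%Z = 0) by (apply NNPP; intros N; apply Hz; eauto).
    rewrite E; ring.
Qed.

(** * Composition *)

Definition laurent_comp (g f : laurent) : laurent :=
  fun n => tsum (fun k : Z => g k * lpow f (Z.to_nat k) n).

(** Existence of the composition with absolutely convergent coefficients. Since
    existence of powers is inherited by smaller exponents, it is enough to ask
    for the exponents in the support of [g]; this avoids the degree. *)
Definition comp_summable (g f : laurent) : Prop :=
  (forall k : nat, g (Z.of_nat k) <> 0 -> pow_summable f k) /\
  forall n, summable (fun k : Z => g k * lpow f (Z.to_nat k) n).

Definition one_sided (g : laurent) : Prop := forall z, (z < 0)%Z -> g z = 0.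

Lemma is_power_series_iff (g : laurent) :
  is_power_series g <-> one_sided g.
Proof.
  unfold is_power_series, deg_minus; split.
  - intros H z Hz; apply NNPP; intros N.
    match type of H with Lub_Rbar ?E = _ => destruct (Lub_Rbar_correct E) as [Ub _] end.
    rewrite H in Ub; assert (B := Ub (INR (Z.to_nat (- z)))); simpl in B.
    assert (P : (0 < INR (Z.to_nat (- z)))%R) by (apply lt_0_INR; lia).
    apply (Rlt_not_le _ _ P), B; right; exists (Z.to_nat (- z)).
    split; [lia|]; split; [|reflexivity].
    replace (- Z.of_nat (Z.to_nat (- z)))%Z with z by lia; exact N.
  - intros H; apply is_lub_Rbar_unique; split.
    + intros x [->|(n & Hn & N & _)]; [apply Rbar_le_refl|].
      elim N; apply H; lia.
    + intros b Hb; apply Hb; now left.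
Qed.

(** For positive [k], if all coefficients from [k] on vanished, then [k - 1] would
    bound the set whose supremum is the degree. *)
Lemma le_deg_plus (g : laurent) k :
  Rbar_le (INR k) (deg_plus g) <->
  k = O \/ exists j, (k <= j)%nat /\ g (Z.of_nat j) <> 0.
Proof.
  unfold deg_plus.
  match goal with |- Rbar_le _ (Lub_Rbar ?E) <-> _ => destruct (Lub_Rbar_correct E) as [Ub Lb] end.
  split.
  - intros H; destruct k as [|k]; [now left|right].
    apply NNPP; intros N.
    assert (B : Rbar_le (INR (S k)) (INR k)).
    { apply Rbar_le_trans with (1 := H), Lb; intros x [->|(n & Hn & ->)]; simpl.
      - apply pos_INR.
      - apply le_INR, Nat.lt_succ_r, Nat.nle_gt; intros Hle; apply N; eauto. }
    change (INR (S k) <= INR k)%R in B; apply INR_le in B; lia.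
  - intros [->|(j & Hj & Nj)].
    + apply Ub; now left.
    + apply Rbar_le_trans with (INR j); [now apply le_INR | apply Ub; right; eauto].
Qed.

Lemma pow_summable_upto_deg (g f : laurent) :
  (forall k, g (Z.of_nat k) <> 0 -> pow_summable f k) ->
  forall k, Rbar_le (INR k) (deg_plus g) -> pow_summable f k.
Proof.
  intros H k Hk; apply le_deg_plus in Hk as [->|(j & Hj & Nj)].
  - intros j Hj; lia.
  - exact (pow_summable_le _ _ _ Hj (H j Nj)).
Qed.

Lemma sum_upto_deg (g : laurent) (P : nat -> laurent) n :
  (fun k : nat => if Rbar_le_dec (INR k) (deg_plus g) then g (Z.of_nat k) * P k n else RtoC 0)
  = fun k => g (Z.of_nat k) * P k n.
Proof.
  extensionality k; destruct Rbar_le_dec as [|N]; [reflexivity|].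
  replace (g (Z.of_nat k)) with (RtoC 0); [ring|].
  symmetry; apply NNPP; intros Nk; apply N, le_deg_plus; eauto.
Qed.

Lemma comp_summable_is_comp g f :
  is_power_series g -> comp_summable g f -> is_comp g f (laurent_comp g f).
Proof.
  intros Hg [Ok S]; split; [exact Hg|]; exists (lpow f); split.
  - intros k Hk; apply pow_summable_is_pow; now apply (pow_summable_upto_deg g).
  - intros n; unfold is_sum_upto; rewrite sum_upto_deg.
    rewrite is_power_series_iff in Hg.
    assert (H := is_series_tsumZ (fun k : Z => g k * lpow f (Z.to_nat k) n)).
    replace (fun k : nat => g (Z.of_nat k) * lpow f k n) with
      (fun k : nat => g (Z.of_nat k) * lpow f (Z.to_nat (Z.of_nat k)) n)
      by (extensionality k; now rewrite Nat2Z.id).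
    apply H; auto; intros z Hz; rewrite Hg by exact Hz; ring.
Qed.

Lemma nonnegative_comp_coef (g f : laurent) n :
  nonnegative g -> nonnegative f -> one_sided g ->
  (forall k : nat, g (Z.of_nat k) <> 0 -> pow_summable f k) ->
  nonnegative (fun k : Z => g k * lpow f (Z.to_nat k) n).
Proof.
  intros Hg Hf Hz Ok k; rewrite Cmod_mult, RtoC_mult, Hg.
  destruct (classic (g k = 0)) as [->|N]; [ring|].
  rewrite nonnegative_lpow; auto; apply Ok; rewrite Z2Nat.id; auto.
  destruct (Z_lt_dec k 0); [elim N; auto | lia].
Qed.

Lemma is_comp_comp_summable g f p :
  nonnegative g -> nonnegative f -> is_comp g f p -> comp_summable g f /\ p = laurent_comp g f.
Proof.
  intros Hg Hf (Hps & P & HP & Hs).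
  assert (Ok : forall k : nat, g (Z.of_nat k) <> 0 -> pow_summable f k /\ P k = lpow f k).
  { intros k Nk; apply is_pow_pow_summable; auto; apply HP, le_deg_plus; eauto. }
  rewrite is_power_series_iff in Hps.
  assert (Q : forall n, is_sumZ (fun k : Z => g k * lpow f (Z.to_nat k) n) (p n)).
  { intros n; apply is_series_is_sumZ.
    - intros z Hz; rewrite Hps by exact Hz; ring.
    - specialize (Hs n); unfold is_sum_upto in Hs; rewrite sum_upto_deg in Hs.
      replace (fun k => g (Z.of_nat k) * P k n) with
        (fun k => g (Z.of_nat k) * lpow f (Z.to_nat (Z.of_nat k)) n) in Hs; [exact Hs|].
      extensionality k; rewrite Nat2Z.id.
      destruct (classic (g (Z.of_nat k) = 0)) as [->|N]; [ring|].
      now rewrite (proj2 (Ok k N)). }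
  assert (S : forall n, summable (fun k : Z => g k * lpow f (Z.to_nat k) n)).
  { intros n; apply is_sumZ_nonnegative_summable with (2 := Q n).
    apply nonnegative_comp_coef; auto; intros k Nk; now apply Ok. }
  split; [split; [intros k Nk; now apply Ok | exact S]|].
  extensionality n; apply (is_sumZ_unique _ _ _ (Q n)), is_sumZ_tsum, S.
Qed.

(** * The multiplication theorem for absolutely summable data *)

(** Exponents are integers below, while existence of powers speaks of natural
    numbers; a nonzero coefficient allows passing from one to the other. *)
Lemma one_sided_case (g : laurent) k (Q : nat -> Prop) :
  one_sided g -> (forall k : nat, g (Z.of_nat k) <> 0 -> Q k) ->
  g k <> 0 -> (0 <= k)%Z /\ Q (Z.to_nat k).
Proof.
  intros Hg H Nk; destruct (Z_lt_dec k 0) as [Hk|Hk]; [elim Nk; auto|].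
  split; [lia|]; apply H; rewrite Z2Nat.id; auto; lia.
Qed.

Lemma Cmult_neq_0_inv (x y : C) : x * y <> 0 -> x <> 0 /\ y <> 0.
Proof. intros H; split; intros ->; apply H; ring. Qed.

Lemma conv_summable_power_series g h : one_sided g -> one_sided h -> conv_summable g h.
Proof.
  intros Hg Hh n.
  apply (summable_finite _ (map Z.of_nat (seq 0 (S (Z.to_nat n))))); intros m Hm.
  destruct (Z_lt_dec m 0) as [H|H]; [rewrite (Hg m H); ring|].
  destruct (Z_lt_dec (n - m) 0) as [H'|H']; [rewrite (Hh _ H'); ring|].
  elim Hm; apply in_map_iff; exists (Z.to_nat m); split; [lia | apply in_seq; lia].
Qed.

Lemma one_sided_conv g h :
  one_sided g -> one_sided h -> one_sided (conv g h).
Proof.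
  intros Hg Hh n Hn; apply tsum_zero; intros m.
  destruct (Z_lt_dec m 0) as [H|H]; [rewrite (Hg m H); ring|].
  rewrite (Hh (n - m)%Z) by lia; ring.
Qed.

(** The triple family of which both sides are iterated sums, indexed by [m] and
    the pair [(k, l)]. *)
Definition prod_term (g h f : laurent) (n m : Z) (kl : Z * Z) : C :=
  (g (fst kl) * lpow f (Z.to_nat (fst kl)) m) *
  (h (snd kl) * lpow f (Z.to_nat (snd kl)) (n - m)%Z).

(** What is left of [prod_term] after summation over [m]. *)
Definition comp_term (g h f : laurent) (n k l : Z) : C :=
  g k * h l * lpow f (Z.to_nat (k + l)) n.

(** The powers occurring in the composition of the product [g h] with [f]; a
    power [f^(k+l)] is only asked for when [g k] and [h l] do not vanish. *)
Definition sum_powers_summable (g h f : laurent) : Prop :=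
  forall k l : nat, g (Z.of_nat k) <> 0 -> h (Z.of_nat l) <> 0 -> pow_summable f (k + l).

Lemma prod_term_row g h f n m :
  comp_summable g f -> comp_summable h f ->
  summable (prod_term g h f n m) /\
  tsum (prod_term g h f n m) = laurent_comp g f m * laurent_comp h f (n - m)%Z.
Proof.
  intros [_ Sg] [_ Sh]; split.
  - exact (summable_tensor _ _ (Sg m) (Sh (n - m)%Z)).
  - exact (tsum_tensor _ _ (Sg m) (Sh (n - m)%Z)).
Qed.

Lemma prod_term_column g h f n kl :
  one_sided g -> one_sided h -> sum_powers_summable g h (laurent_abs f) ->
  summable (fun m => prod_term g h f n m kl) /\
  tsum (fun m => prod_term g h f n m kl) = pair_family (comp_term g h f n) kl.
Proof.
  intros Hg Hh Ok; destruct kl as [k l].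
  assert (E : (fun m => prod_term g h f n m (k, l)) =
     fun m => g k * h l * (lpow f (Z.to_nat k) m * lpow f (Z.to_nat l) (n - m)%Z)).
  { extensionality m; unfold prod_term; simpl; ring. }
  rewrite E; unfold pair_family, comp_term; cbn [fst snd].
  destruct (classic (g k * h l = 0)) as [Z|N].
  - rewrite Z; split.
    + apply (summable_finite _ nil); intros; ring.
    + rewrite tsum_zero; intros; ring.
  - apply Cmult_neq_0_inv in N as [Nk Nl].
    destruct (one_sided_case g k (fun k => forall l : nat, h (Z.of_nat l) <> 0 ->
      pow_summable (laurent_abs f) (k + l)) Hg) as [Pk Q]; auto.
    destruct (one_sided_case h l _ Hh Q Nl) as [Pl Q'].
    destruct (lpow_add f _ _ Q') as [Okf Ef].
    split; [apply summable_scal, Okf|].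
    rewrite tsum_scal by apply Okf.
    rewrite Z2Nat.inj_add by assumption; now rewrite <- Ef.
Qed.

Lemma diagonals_comp_term g h f n s :
  diagonals (comp_term g h f n) s =
  fun k => lpow f (Z.to_nat s) n * (g k * h (s - k)%Z).
Proof.
  extensionality k; unfold diagonals, comp_term.
  replace (k + (s - k))%Z with s by lia; ring.
Qed.

Lemma tsum_diagonals_comp_term g h f n :
  conv_summable g h ->
  (fun s => tsum (diagonals (comp_term g h f n) s)) =
  fun s => conv g h s * lpow f (Z.to_nat s) n.
Proof.
  intros H; extensionality s; rewrite diagonals_comp_term, tsum_scal by apply H.
  apply Cmult_comm.
Qed.

Lemma conv_neq_0 g h s :
  conv g h s <> 0 -> exists k, g k <> 0 /\ h (s - k)%Z <> 0.
Proof.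
  intros N; apply NNPP; intros H; apply N, tsum_zero; intros k.
  apply NNPP; intros Nk; apply Cmult_neq_0_inv in Nk; eauto.
Qed.

Lemma pow_summable_conv g h f :
  one_sided g -> one_sided h -> sum_powers_summable g h f ->
  forall k : nat, conv g h (Z.of_nat k) <> 0 -> pow_summable f k.
Proof.
  intros Hg Hh Ok k N; apply conv_neq_0 in N as (i & Ni & Nj).
  destruct (one_sided_case g i (fun k => forall l : nat, h (Z.of_nat l) <> 0 ->
      pow_summable f (k + l)) Hg) as [Pk Q]; auto.
  destruct (one_sided_case h _ _ Hh Q Nj) as [Pl Q'].
  revert Q'; apply pow_summable_le; lia.
Qed.

(** Fubini for [prod_term]: rows give the product of the compositions, columns
    give [comp_term], which is then summed along diagonals. *)
Lemma comp_mult g h f :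
  one_sided g -> one_sided h -> comp_summable g f -> comp_summable h f ->
  sum_powers_summable g h (laurent_abs f) ->
  (forall n, summable (pair_family (prod_term g h f n))) ->
  conv_summable (laurent_comp g f) (laurent_comp h f) /\ comp_summable (conv g h) f /\
  conv (laurent_comp g f) (laurent_comp h f) = laurent_comp (conv g h) f.
Proof.
  intros Hg Hh Cg Ch Ok S.
  assert (R : forall n, (fun m => laurent_comp g f m * laurent_comp h f (n - m)%Z)
                        = fun m => tsum (prod_term g h f n m)).
  { intros n; extensionality m; symmetry; now apply prod_term_row. }
  assert (K : forall n, (fun kl => tsum (fun m => prod_term g h f n m kl))
                        = pair_family (comp_term g h f n)).
  { intros n; extensionality kl; now apply prod_term_column. }
  assert (W : forall n, summable (pair_family (comp_term g h f n))).
  { intros n; rewrite <- K; now apply summable_rows, (summable_swap (prod_term g h f n)). }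
  assert (Pgh : conv_summable g h) by now apply conv_summable_power_series.
  split; [|split; [split|]].
  - intros n; rewrite R; now apply summable_rows.
  - apply pow_summable_conv; auto; intros k l Nk Nl; now apply lpow_le, Ok.
  - intros n; rewrite <- tsum_diagonals_comp_term by assumption.
    now apply summable_rows, summable_diagonals.
  - extensionality n; unfold conv at 1, laurent_comp at 3.
    rewrite R, tsum_exchange, K by apply S.
    rewrite <- tsum_diagonals_comp_term by assumption.
    rewrite tsum_rows by now apply summable_diagonals.
    symmetry; now apply tsum_diagonals.
Qed.

(** * Passing from moduli to complex coefficients *)

Lemma Cmod_laurent_abs f n : Cmod (laurent_abs f n) = Cmod (f n).
Proof. apply Cmod_RtoC_Cmod. Qed.

Lemma laurent_abs_neq_0 (g : laurent) n : g n <> 0 -> laurent_abs g n <> 0.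
Proof. now rewrite !Cmod_gt_0, Cmod_laurent_abs. Qed.

Lemma one_sided_abs (g : laurent) : one_sided g -> one_sided (laurent_abs g).
Proof. intros H z Hz; unfold laurent_abs; now rewrite (H z Hz), Cmod_0. Qed.

(** Where [g] vanishes the power need not exist, but both sides are zero. *)
Lemma Cmod_coef_lpow_le g f k n :
  one_sided g -> comp_summable (laurent_abs g) (laurent_abs f) ->
  (Cmod (g k * lpow f (Z.to_nat k) n) <=
   Cmod (laurent_abs g k * lpow (laurent_abs f) (Z.to_nat k) n))%R.
Proof.
  intros Hg [Ok _]; rewrite !Cmod_mult, Cmod_laurent_abs.
  destruct (classic (g k = 0)) as [->|N]; [rewrite Cmod_0; lra|].
  apply Rmult_le_compat_l; [apply Cmod_ge_0|].
  apply lpow_le; apply (one_sided_case _ k _ (one_sided_abs _ Hg) Ok).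
  now apply laurent_abs_neq_0.
Qed.

Lemma comp_summable_of_abs g f :
  one_sided g -> comp_summable (laurent_abs g) (laurent_abs f) -> comp_summable g f.
Proof.
  intros Hg C; split.
  - intros k Nk; apply lpow_le, C; now apply laurent_abs_neq_0.
  - intros n; apply summable_le with (2 := proj2 C n); intros k.
    now apply Cmod_coef_lpow_le.
Qed.

Lemma summable_prod_term_of_abs g h f n :
  one_sided g -> one_sided h ->
  comp_summable (laurent_abs g) (laurent_abs f) -> comp_summable (laurent_abs h) (laurent_abs f) ->
  summable (pair_family (prod_term (laurent_abs g) (laurent_abs h) (laurent_abs f) n)) ->
  summable (pair_family (prod_term g h f n)).
Proof.
  intros Hg Hh Cg Ch; apply summable_le; intros [m [k l]];
    unfold pair_family, prod_term; cbn [fst snd].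
  rewrite (Cmod_mult (g k * _)), (Cmod_mult (laurent_abs g k * _)).
  apply Rmult_le_compat; auto using Cmod_ge_0, Cmod_coef_lpow_le.
Qed.

(** * Exploiting either hypothesis *)

(** Tonelli with the sum over pairs inside: each row is the tensor product of two
    summable families, and the row sums are the terms of the product of the two
    compositions. *)
Lemma summable_prod_term_prod g h a n :
  nonnegative g -> nonnegative h -> nonnegative a ->
  one_sided g -> one_sided h ->
  comp_summable g a -> comp_summable h a -> conv_summable (laurent_comp g a) (laurent_comp h a) ->
  summable (pair_family (prod_term g h a n)).
Proof.
  intros Ng Nh Na Hg Hh Cg Ch Ok; apply summable_pair_family.
  - intros m; now apply prod_term_row.
  - apply summable_le with (2 := Ok n); intros m.
    right; f_equal; rewrite <- (proj2 (prod_term_row g h a n m Cg Ch)).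
    f_equal; extensionality kl; unfold prod_term.
    rewrite Cmod_mult, RtoC_mult; f_equal.
    + apply (nonnegative_comp_coef g a m); auto; apply Cg.
    + apply (nonnegative_comp_coef h a (n - m)); auto; apply Ch.
Qed.

Lemma nonnegative_comp g a :
  nonnegative g -> nonnegative a -> one_sided g -> comp_summable g a ->
  nonnegative (laurent_comp g a).
Proof.
  intros Ng Na Hg [Ok S] n; apply tsum_nonnegative; auto using nonnegative_comp_coef.
Qed.

(** Up to the nonzero factor [g k * h l], a column of [prod_term] consists of the
    terms of a coefficient of the product of [a^k] and [a^l]. *)
Lemma sum_powers_summable_prod g h a :
  nonnegative a -> comp_summable g a -> comp_summable h a ->
  (forall n, summable (pair_family (prod_term g h a n))) -> sum_powers_summable g h a.
Proof.
  intros Na [Og _] [Oh _] S k l Nk Nl; apply pow_summable_add; auto.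
  intros n; assert (T := summable_row _ (Z.of_nat k, Z.of_nat l) (summable_swap _ (S n))).
  apply (summable_scal (/ (g (Z.of_nat k) * h (Z.of_nat l)))) in T.
  apply summable_le with (2 := T); intros m; unfold prod_term; cbn [fst snd].
  rewrite !Nat2Z.id; right; f_equal; field; auto.
Qed.

(** The nonnegative summand [g k * h l] makes the coefficient [k + l] of the
    product nonzero: moduli cannot cancel. *)
Lemma sum_powers_summable_comp g h a :
  nonnegative g -> nonnegative h -> conv_summable g h ->
  comp_summable (conv g h) a -> sum_powers_summable g h a.
Proof.
  intros Ng Nh P [Ok _] k l Nk Nl; apply Ok; rewrite Nat2Z.inj_add.
  apply Cmod_gt_0.
  assert (B := Cmod_le_tsum _ (Z.of_nat k)
    (nonnegative_term g h (Z.of_nat k + Z.of_nat l) Ng Nh) (P _)).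
  cbv beta in B.
  replace (Z.of_nat k + Z.of_nat l - Z.of_nat k)%Z with (Z.of_nat l) in B by lia.
  apply Rlt_le_trans with (2 := B).
  rewrite Cmod_mult; apply Rmult_lt_0_compat; now apply Cmod_gt_0.
Qed.

Lemma nonnegative_comp_term g h a n :
  nonnegative g -> nonnegative h -> nonnegative a ->
  one_sided g -> one_sided h -> sum_powers_summable g h a ->
  nonnegative (pair_family (comp_term g h a n)).
Proof.
  intros Ng Nh Na Hg Hh Ok [k l]; unfold pair_family, comp_term; cbn [fst snd].
  rewrite !Cmod_mult, !RtoC_mult, Ng, Nh.
  destruct (classic (g k * h l = 0)) as [Z|N]; [rewrite Z; ring|].
  rewrite nonnegative_lpow; auto.
  apply Cmult_neq_0_inv in N as [Nk Nl].
  destruct (one_sided_case g k (fun k => forall l : nat, h (Z.of_nat l) <> 0 ->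
      pow_summable a (k + l)) Hg) as [Pk Q]; auto.
  destruct (one_sided_case h l _ Hh Q Nl) as [Pl Q'].
  rewrite Z2Nat.inj_add; auto.
Qed.

(** Tonelli with the sum over [m] inside, applied twice: the composition of the
    product is the iterated sum of [comp_term] along diagonals, and [comp_term]
    is the family of column sums of [prod_term]. *)
Lemma summable_prod_term_comp g h a n :
  nonnegative g -> nonnegative h -> nonnegative a ->
  one_sided g -> one_sided h ->
  comp_summable g a -> comp_summable h a -> comp_summable (conv g h) a ->
  summable (pair_family (prod_term g h a n)).
Proof.
  intros Ng Nh Na Hg Hh Cg Ch C.
  assert (P : conv_summable g h) by now apply conv_summable_power_series.
  assert (Ok : sum_powers_summable g h a) by now apply sum_powers_summable_comp.
  assert (W := nonnegative_comp_term g h a n Ng Nh Na Hg Hh Ok).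
  assert (SW : summable (pair_family (comp_term g h a n))).
  { apply summable_diagonals, summable_pair_family.
    - intros s; rewrite diagonals_comp_term; apply summable_scal, P.
    - apply summable_le with (2 := proj2 C n); intros s.
      rewrite <- (f_equal (fun u => u s) (tsum_diagonals_comp_term g h a n P)).
      right; f_equal; f_equal; extensionality k; apply (W (k, s - k)%Z). }
  apply (summable_swap (fun kl m => prod_term g h a n m kl)), summable_pair_family.
  - intros kl; apply prod_term_column; auto.
    now rewrite (laurent_abs_nonnegative a Na).
  - replace (fun kl => tsum (fun m => RtoC (Cmod (prod_term g h a n m kl))))
      with (pair_family (comp_term g h a n)); [exact SW|].
    extensionality kl; rewrite <- (proj2 (prod_term_column g h a n kl Hg Hh
      (eq_ind_r (sum_powers_summable g h) Ok (laurent_abs_nonnegative a Na)))).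
    f_equal; extensionality m; unfold prod_term; symmetry.
    rewrite Cmod_mult, RtoC_mult; f_equal.
    + apply (nonnegative_comp_coef g a m); auto; apply Cg.
    + apply (nonnegative_comp_coef h a (n - m)); auto; apply Ch.
Qed.

Theorem proposition5p7 (g h f : laurent)
  (hg : is_power_series g) (hh : is_power_series h)
  (absgf abshf : laurent)
  (hgf : is_comp (laurent_abs g) (laurent_abs f) absgf)
  (hhf : is_comp (laurent_abs h) (laurent_abs f) abshf)
  (hab : (exists p : laurent, is_prod absgf abshf p) \/
         (exists absgh p : laurent,
            is_prod (laurent_abs g) (laurent_abs h) absgh /\
            is_comp absgh (laurent_abs f) p)) :
  exists gf hf gh p q : laurent,
    is_comp g f gf /\
    is_comp h f hf /\
    is_prod gf hf p /\
    is_prod g h gh /\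
    is_comp gh f q /\
    p = q.
Proof.
  assert (Hg := proj1 (is_power_series_iff g) hg).
  assert (Hh := proj1 (is_power_series_iff h) hh).
  assert (Hg' := one_sided_abs _ Hg); assert (Hh' := one_sided_abs _ Hh).
  assert (Ng : nonnegative (laurent_abs g)) by apply nonnegative_Cmod.
  assert (Nh : nonnegative (laurent_abs h)) by apply nonnegative_Cmod.
  assert (Nf : nonnegative (laurent_abs f)) by apply nonnegative_Cmod.
  apply is_comp_comp_summable in hgf as [Cg ->]; auto.
  apply is_comp_comp_summable in hhf as [Ch ->]; auto.
  assert (H : sum_powers_summable (laurent_abs g) (laurent_abs h) (laurent_abs f) /\
    forall n, summable (pair_family (prod_term (laurent_abs g) (laurent_abs h) (laurent_abs f) n))).
  { destruct hab as [[p Hp]|(absgh & p & Hp & Hc)].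
    - apply is_prod_conv_summable in Hp as [K _]; auto using nonnegative_comp.
      assert (S : forall n,
        summable (pair_family (prod_term (laurent_abs g) (laurent_abs h) (laurent_abs f) n)))
        by (intros n; now apply summable_prod_term_prod).
      split; [now apply sum_powers_summable_prod | exact S].
    - apply is_prod_conv_summable in Hp as [K ->]; auto.
      apply is_comp_comp_summable in Hc as [C _]; auto using nonnegative_conv.
      split; [now apply sum_powers_summable_comp | intros n; now apply summable_prod_term_comp]. }
  destruct H as [Ok S].
  assert (Cg' := comp_summable_of_abs _ _ Hg Cg); assert (Ch' := comp_summable_of_abs _ _ Hh Ch).
  destruct (comp_mult g h f Hg Hh Cg' Ch') as (K & C & E).
  - intros k l Nk Nl; apply Ok; now apply laurent_abs_neq_0.
  - intros n; now apply summable_prod_term_of_abs.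
  - exists (laurent_comp g f), (laurent_comp h f), (conv g h),
      (conv (laurent_comp g f) (laurent_comp h f)), (laurent_comp (conv g h) f).
    split; [now apply comp_summable_is_comp|].
    split; [now apply comp_summable_is_comp|].
    split; [now apply conv_summable_is_prod|].
    split; [now apply conv_summable_is_prod, conv_summable_power_series|].
    split; [|exact E].
    apply comp_summable_is_comp; auto; apply is_power_series_iff; now apply one_sided_conv.
Qed.
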